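(* Let $\alpha>0$, $0<\xi<1$. For all $x,y\in\mathbb{Z}$, $$\boldsymbol\Phi_{\alpha,\xi}(x,y)=\tfrac12(-1)^{\min(x,0)+\max(y,0)}\Big[\underline K_{\nu(\alpha)-\frac12,-\nu(\alpha)-\frac12,\xi}(x+\tfrac12,-y+\tfrac12)+\underline K_{\nu(\alpha)+\frac12,-\nu(\alpha)+\frac12,\xi}(x-\tfrac12,-y-\tfrac12)\Big].$$
   Context: $\nu=\nu(\alpha)=\frac12\sqrt{1-4\alpha}$ (real in $[0,\frac12)$ if $\alpha\le\frac14$, purely imaginary otherwise; sign irrelevant). For $x,m\in\mathbb{Z}$, $$\varphi_m(x;\alpha,\xi)=\left(\frac{\Gamma(\frac12+\nu+x)\Gamma(\frac12-\nu+x)}{\Gamma(\frac12+\nu-m)\Gamma(\frac12-\nu-m)}\right)^{\frac12}\xi^{\frac12(x+m)}(1-\xi)^{-m}\,\frac{{}_2F_1(\frac12+\nu+m,\frac12-\nu+m;x+m+1;\frac{\xi}{\xi-1})}{\Gamma(x+m+1)},$$ where ${}_2F_1(A,B;C;w)/\Gamma(C)$ is the regularized Gauss hypergeometric function (entire in $C$; analytically continued in $w\in\mathbb{C}\setminus[1,\infty)$). The static Pfaffian kernel is $$\boldsymbol\Phi_{\alpha,\xi}(x,y)=(-1)^{\min(x,0)+\max(y,0)}\sum_{m=0}^{\infty}2^{-\delta(m)}\varphi_m(x;\alpha,\xi)\varphi_m(-y;\alpha,\xi),\qquad x,y\in\mathbb{Z},\quad\delta(m)=\delta_{m,0}.$$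 Discrete hypergeometric kernel: let $\mathbb{Z}'=\mathbb{Z}+\frac12$, $\mathbb{Z}'_+$ its positive part. For admissible $z,z'$ (either non-real complex conjugate, or both real in a common interval $(m,m+1)$, $m\in\mathbb{Z}$) and $a,x\in\mathbb{Z}'$, $$\psi_a(x;z,z',\xi)=\left(\frac{\Gamma(x+z+\frac12)\Gamma(x+z'+\frac12)}{\Gamma(-a+z+\frac12)\Gamma(-a+z'+\frac12)}\right)^{\frac12}\xi^{\frac12(x+a)}(1-\xi)^{\frac12(z+z')-a}\,\frac{{}_2F_1(-z+a+\frac12,-z'+a+\frac12;x+a+1;\frac{\xi}{\xi-1})}{\Gamma(x+a+1)},$$ and $\underline K_{z,z',\xi}(x,y)=\sum_{a\in\mathbb{Z}'_+}\psi_a(x;z,z',\xi)\psi_a(y;z,z',\xi)$, $x,y\in\mathbb{Z}'$. *)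

(* Defs.v *)
From HB Require Import structures.
From mathcomp Require Import all_boot all_order all_algebra.
From mathcomp Require Import complex.
From mathcomp Require Import all_classical all_reals all_analysis.

Set Implicit Arguments.
Unset Strict Implicit.
Unset Printing Implicit Defensive.

Import Order.TTheory GRing.Theory Num.Theory.
Import numFieldNormedType.Exports.

Local Open Scope classical_set_scope.
Local Open Scope ring_scope.
Local Open Scope complex_scope.

Section Complex_analysis.
Variable R : realType.
Implicit Types (A B C s w z : R[i]).

(* R[i] carries its norm topology through the regular module R[i]^o. *)
Definition clim (u : nat -> R[i]) : R[i] := limn (u : nat -> R[i]^o).

Definition csum (u : nat -> R[i]) : R[i] :=
  clim (fun n => \sum_(0 <= k < n) u k).

Definition cexp z : R[i] :=
  (expR (complex.Re z))%:C * (cos (complex.Im z) +i* sin (complex.Im z)).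

(* t ^ s for a positive real base t. *)
Definition cpow (t : R) s : R[i] := cexp (s * (ln t)%:C).

Definition poch z (n : nat) : R[i] := \prod_(0 <= k < n) (z + k%:R).

(* Euler-Gauss product.  At the poles 0, -1, -2, ... the terms are eventually
   divided by zero, so the value is 0 there; hence (Gamma z)^-1 is the entire
   reciprocal Gamma function, including its zeros. *)
Definition Gamma z : R[i] :=
  clim (fun n => n`!%:R * cpow n%:R z / poch z n.+1).

(* Power series of 2F1(A, B; C; w) / Gamma(C), for `|w| < 1: since
   (C)_n Gamma(C) = Gamma(C + n), this makes sense for every C. *)
Definition hyp2F1reg_series A B C w : R[i] :=
  csum (fun n => poch A n * poch B n / (Gamma (C + n%:R) * n`!%:R) * w ^+ n).

(* The complement of [1, +oo[: in R[i], 1 <= w means that w is real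
   and at least 1. *)
Definition slit_plane : set R[i] := [set w | ~~ (1 <= w)].

Definition is_hyp2F1reg A B C (F : R[i] -> R[i]) : Prop :=
  (forall w, slit_plane w -> derivable (F : R[i]^o -> R[i]^o) w 1) /\
  (forall w, `|w| < 1 -> F w = hyp2F1reg_series A B C w).

(* Analytic continuation to the slit plane, which determines the value
   at every w in slit_plane; the value elsewhere is irrelevant. *)
Definition hyp2F1reg A B C : R[i] -> R[i] :=
  xget (fun=> 0) [set F | is_hyp2F1reg A B C F].

End Complex_analysis.

Section Kernels.
Variable R : realType.
Implicit Types (alpha xi a : R) (z : R[i]).

Definition nu alpha : R[i] := 2^-1 * sqrtC (1 - 4 * alpha)%:C.

(* The argument of the square root is a nonnegative real, on which sqrtC is
   the nonnegative square root. *)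
Definition phi (m x : int) alpha xi : R[i] :=
  let v := nu alpha in
  sqrtC ((Gamma (2^-1 + v + x%:~R) * Gamma (2^-1 - v + x%:~R)) /
         (Gamma (2^-1 + v - m%:~R) * Gamma (2^-1 - v - m%:~R))) *
  (xi `^ (2^-1 * (x + m)%:~R))%:C * ((1 - xi) ^ (- m))%:C *
  hyp2F1reg (2^-1 + v + m%:~R) (2^-1 - v + m%:~R) (x + m + 1)%:~R
    (xi / (xi - 1))%:C.

Definition Phi alpha xi (x y : int) : R[i] :=
  (-1) ^ (Num.min x 0 + Num.max y 0) *
  csum (fun m : nat => 2 ^- (m == 0%N) * phi m x alpha xi * phi m (- y) alpha xi).

(* Elements of Z' = Z + 1/2 are represented by their real values; the
   definitions are only meant for a, x, y in Z' and admissible z, z'. *)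
Definition psi a (x : R) z (z' : R[i]) xi : R[i] :=
  sqrtC ((Gamma (x%:C + z + 2^-1) * Gamma (x%:C + z' + 2^-1)) /
         (Gamma (- a%:C + z + 2^-1) * Gamma (- a%:C + z' + 2^-1))) *
  (xi `^ (2^-1 * (x + a)))%:C * cpow (1 - xi) (2^-1 * (z + z') - a%:C) *
  hyp2F1reg (- z + a%:C + 2^-1) (- z' + a%:C + 2^-1) (x + a + 1)%:C
    (xi / (xi - 1))%:C.

Definition hypergeometric_kernel z (z' : R[i]) xi (x y : R) : R[i] :=
  csum (fun n : nat =>
    psi (n%:R + 2^-1) x z z' xi * psi (n%:R + 2^-1) y z z' xi).

End Kernels.

(* Main.v *)
Require Import Defs.
From mathcomp Require Import all_boot all_order all_algebra.
From mathcomp Require Import ring.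
From mathcomp Require Import complex.
From mathcomp Require Import all_classical all_reals all_analysis.

Import Order.TTheory GRing.Theory Num.Theory.
Local Open Scope ring_scope.
Local Open Scope classical_set_scope.
Local Open Scope complex_scope.

(* Both [psi] families are reindexings of the functions phi_m: the first by
   m = a + 1/2 >= 1, the second by m = a - 1/2 >= 0.  The two kernels are thus
   the tail and the whole of the series sum_m phi_m(x) phi_m(-y), and their
   average halves exactly the term m = 0. *)

(** The series is termwise symmetric in [A] and [B], so both sides apply [xget] to the same set of
    continuations. *)
Lemma hyp2F1reg_sym (R : realType) (A B C w : R[i]) :
  hyp2F1reg A B C w = hyp2F1reg B A C w.
Proof.
rewrite /hyp2F1reg; congr (xget _ _ w); apply/seteqP.
by split=> F [dF F_series]; split=> // v v1; rewrite F_series//;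
  congr csum; apply/funext => n; rewrite [poch _ _ * _]mulrC.
Qed.

(** Reconciles the powers of [1 - xi]: a complex one in [psi], an integer one in [phi]. *)
Lemma cpow_intr (R : realType) (t : R) (m : int) :
  0 < t -> cpow t m%:~R = (t ^ m)%:C.
Proof.
move=> t0; rewrite /cpow -(rmorph_int (real_complex R)) -rmorphM /cexp /=.
rewrite sin0 cos0 mulr1; congr (_ %:C).
by rewrite -powR_intmul ?ltW// /powR gt_eqF.
Qed.

(** [psi] depends on its arguments only through [t + a], [t + z] and [t + z']; for instance [z - a]
    is [(t + z) - (t + a)]. Fixing these three sums covers both half-integer shifts at once. *)
Lemma psi_phi (R : realType) (alpha xi a t : R) (z z' : R[i]) (m x : int) :
  xi < 1 -> t + a = (x + m)%:~R ->
  t%:C + z = nu alpha + x%:~R -> t%:C + z' = - nu alpha + x%:~R ->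
  psi a t z z' xi = phi m x alpha xi.
Proof.
move=> xi1 ta tz tz'.
have aE : a%:C = x%:~R + m%:~R - t%:C.
  apply: (addrI t%:C); rewrite -rmorphD ta rmorph_int intrD; ring.
have zE : z = nu alpha + x%:~R - t%:C by rewrite -tz addrC addKr.
have z'E : z' = - nu alpha + x%:~R - t%:C by rewrite -tz' addrC addKr.
have powE : cpow (1 - xi) (2^-1 * (z + z') - a%:C) = ((1 - xi) ^ (- m))%:C.
  have -> : 2^-1 * (z + z') - a%:C = (- m)%:~R.
    by rewrite aE zE z'E intrN; field.
  by apply: cpow_intr; rewrite subr_gt0.
have xE : t%:C + z + 2^-1 = 2^-1 + nu alpha + x%:~R by rewrite tz; ring.
have x'E : t%:C + z' + 2^-1 = 2^-1 - nu alpha + x%:~R by rewrite tz'; ring.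
have mE : - a%:C + z + 2^-1 = 2^-1 + nu alpha - m%:~R by rewrite aE zE; ring.
have m'E : - a%:C + z' + 2^-1 = 2^-1 - nu alpha - m%:~R by rewrite aE z'E; ring.
(* The sign of [z] swaps the two upper parameters relative to [phi], hence the final appeal to
   [hyp2F1reg_sym]. *)
have AE : - z + a%:C + 2^-1 = 2^-1 - nu alpha + m%:~R by rewrite aE zE; ring.
have BE : - z' + a%:C + 2^-1 = 2^-1 + nu alpha + m%:~R by rewrite aE z'E; ring.
have CE : (t + a + 1)%:C = (x + m + 1)%:~R :> R[i].
  by rewrite ta -(rmorph_int (real_complex R)) [in RHS]intrD.
rewrite /psi /phi powE xE x'E mE m'E AE BE CE ta.
by congr (_ * _); exact: hyp2F1reg_sym.
Qed.

Lemma psi_phi_lower (R : realType) (alpha xi : R) (x : int) (n : nat) :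
  xi < 1 ->
  psi (n%:R + 2^-1) (x%:~R + 2^-1) (nu alpha - 2^-1) (- nu alpha - 2^-1) xi
  = phi n.+1 x alpha xi.
Proof.
move=> xi1; apply: psi_phi => //.
- by rewrite intrD -pmulrn -natr1; field.
- by rewrite rmorphD rmorph_int fmorphV rmorph_nat; ring.
- by rewrite rmorphD rmorph_int fmorphV rmorph_nat; ring.
Qed.

Lemma psi_phi_upper (R : realType) (alpha xi : R) (x : int) (n : nat) :
  xi < 1 ->
  psi (n%:R + 2^-1) (x%:~R - 2^-1) (nu alpha + 2^-1) (- nu alpha + 2^-1) xi
  = phi n x alpha xi.
Proof.
move=> xi1; apply: psi_phi => //.
- by rewrite intrD -pmulrn; ring.
- by rewrite rmorphB rmorph_int fmorphV rmorph_nat; ring.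
- by rewrite rmorphB rmorph_int fmorphV rmorph_nat; ring.
Qed.

Lemma cvg_add_cst (R : realType) (u v : nat -> R[i]^o) (c l : R[i]^o) :
  (forall n, v n = u n + c) -> (u @ \oo --> l) -> (v @ \oo --> l + c).
Proof.
move=> vE ul; have -> : v = (fun n => u n + c) by exact/funext.
exact: (cvgD ul (cvg_cst c)).
Qed.

(* No convergence is assumed: the partial sums of the three series differ by
   constants, up to a shift, so they converge together, and otherwise all
   three limits are the same junk value. *)
Lemma csum_half_head (R : realType) (f : nat -> R[i]) :
  csum (fun m => 2 ^- (m == 0%N) * f m) =
  2^-1 * (csum (fun m => f m.+1) + csum f).
Proof.
rewrite /csum /clim.
set S := fun n => \sum_(0 <= k < n) f k.
set T := fun n => \sum_(0 <= k < n) f k.+1.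
set U := fun n => \sum_(0 <= k < n) (2 ^- (k == 0%N) * f k).
have TE n : T n = S n.+1 - f 0%N.
  by rewrite /T /S big_nat_recl//= addrC addKr.
(* The index starts at 1: the empty sums [U 0] and [S 0] are both 0, without the halved head
   term. *)
have UE n : U n.+1 = S n.+1 - 2^-1 * f 0%N.
  rewrite /U /S !big_nat_recl//= expr1 addrAC; congr (_ + _); last first.
    by apply: eq_bigr => i _; rewrite invr1 mul1r.
  by field.
(* Retyped in [R[i]^o], whose norm topology [clim] uses. *)
pose S' : nat -> R[i]^o := S.
pose T' : nat -> R[i]^o := T.
pose U' : nat -> R[i]^o := U.
have shift (u : nat -> R[i]^o) (l : R[i]^o) :
    ((fun n => u n.+1) @ \oo --> l) <-> (u @ \oo --> l).
  by rewrite (cvg_shiftS u).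
have cT (l : R[i]^o) : (S' @ \oo --> l) -> (T' @ \oo --> (l - f 0%N : R[i]^o)).
  by move=> /(shift S' l).2; apply: cvg_add_cst => n; exact: TE.
(* This converse and [cUV] carry divergence of [S'] over to [T'] and [U']. *)
have cTV (l : R[i]^o) : (T' @ \oo --> l) -> (S' @ \oo --> (l + f 0%N : R[i]^o)).
  by move=> Tl; apply: (shift S' _).1; apply: cvg_add_cst Tl => n; rewrite /T' TE subrK.
have cU (l : R[i]^o) :
    (S' @ \oo --> l) -> (U' @ \oo --> (l - 2^-1 * f 0%N : R[i]^o)).
  move=> /(shift S' l).2 Sl; apply: (shift U' _).1.
  by apply: cvg_add_cst Sl => n; exact: UE.
have cUV (l : R[i]^o) :
    (U' @ \oo --> l) -> (S' @ \oo --> (l + 2^-1 * f 0%N : R[i]^o)).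
  move=> /(shift U' l).2 Ul; apply: (shift S' _).1; apply: cvg_add_cst Ul => n.
  by rewrite /U' UE subrK.
have limE := @cvg_lim (R[i]^o) (@norm_hausdorff _ R[i]^o).
have [cS|ncS] := pselect (cvg (S' @ \oo)).
  rewrite (limE _ _ _ U' _ (cU _ cS)) (limE _ _ _ T' _ (cT _ cS)).
  by field.
have ncT : ~ cvg (T' @ \oo) by move=> cvT; apply: ncS; exact: cvgP (cTV _ cvT).
have ncU : ~ cvg (U' @ \oo) by move=> cvU; apply: ncS; exact: cvgP (cUV _ cvU).
have -> : limn U' = point := dvgP ncU.
have -> : limn T' = point := dvgP ncT.
have -> : limn S' = point := dvgP ncS.
(* What remains is that [point] is its own average. *)
by field.
Qed.

Theorem proposition7p6 (R : realType) (alpha xi : R)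
    (halpha : 0 < alpha) (hxi0 : 0 < xi) (hxi1 : xi < 1) (x y : int) :
  Phi alpha xi x y =
    2^-1 * (-1) ^ (Num.min x 0 + Num.max y 0) *
      (hypergeometric_kernel (nu alpha - 2^-1) (- nu alpha - 2^-1) xi
         (x%:~R + 2^-1) (- y%:~R + 2^-1)
     + hypergeometric_kernel (nu alpha + 2^-1) (- nu alpha + 2^-1) xi
         (x%:~R - 2^-1) (- y%:~R - 2^-1)).
Proof.
(* Moving the sign inside the cast exposes the integer [- y], at which the [psi_phi] lemmas
   apply. *)
rewrite /Phi /hypergeometric_kernel -[- y%:~R]intrN.
under [X in csum X + _]funext do rewrite !psi_phi_lower//.
under [X in _ + csum X]funext do rewrite !psi_phi_upper//.
under [X in _ * csum X = _]funext do rewrite -mulrA.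
rewrite (csum_half_head _ (fun m : nat =>
  phi m x alpha xi * phi m (- y) alpha xi)).
by rewrite mulrCA mulrA.
Qed.
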